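(* Let $X$ be a normed space, $\Omega\subset X$ open, $M\subset\Omega$ a nonempty set, $H$ a nonempty set of functions $X\to\overline{\mathbb{R}}$ closed under vertical shifts (i.e. $h+c\in H$ for all $h\in H$, $c\in\mathbb{R}$), and $f_i\colon X\to\mathbb{R}$, $i\in I_0=\{0\}\cup I$, $I=\{1,\ldots,n\}$. Let $x^*\in X$ be a point of local minimum in the problem $$f_0(x)\to\inf,\quad x\in M,\quad f_i(x)\le0,\quad i\in I.$$ Suppose that for each $i\in I_0$ a function $\varphi_i\colon X\to\overline{\mathbb{R}}$ is a strong upper $H$-convex approximation of $f_i$ at $x^*$ such that $\varphi_i(0)=0$ and $\varphi_i$ is Lipschitz continuous in a neighbourhood of zero. Suppose also that the $H$-convex function $$g(x)=\sup\{\varphi_0(x),\varphi_1(x)+f_1(x^* ),\ldots,\varphi_n(x)+f_n(x^* )\},\quad x\in X,$$ is subhomogeneous. Then $0$ is a point of global minimum of $g$ on $T_M(x^* )$.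
   Context: $\overline{\mathbb{R}}=\mathbb{R}\cup\{\pm\infty\}$; for $f\colon X\to\overline{\mathbb{R}}$, $\operatorname{dom}f=\{x: f(x)\in\mathbb{R}\}$. A function $X\to\overline{\mathbb{R}}$ is $H$-convex if it is the pointwise supremum of a nonempty subset of $H$. An $H$-convex function $\varphi\colon X\to\overline{\mathbb{R}}$ is a strong upper $H$-convex approximation of $f$ at $x$ if (1) $\varphi(0)\ge0$ and $0\in\operatorname{int}\operatorname{dom}\varphi$; (2) there exist $r>0$ and $\beta\colon B(0,r)\to\mathbb{R}$, where $B(0,r)$ is the closed ball of radius $r$ centred at $0$, such that $\beta(\Delta x)\to0$ as $\Delta x\to0$ and $f(x+\Delta x)-f(x)\le\varphi(\Delta x)+\|\Delta x\|\beta(\Delta x)$ for all $\Delta x\in B(0,r)$. A function $f\colon X\to\overline{\mathbb{R}}$ with $f(0)=0$ is subhomogeneous if $f(\alpha\Delta x)\le\alpha f(\Delta x)$ for all $\Delta x\in X$, $\alpha\in(0,1)$. $T_M(x^* )$ is the contingent cone to $M$ at $x^*$: the set of $v\in X$ for which there exist sequences $h_n\downarrow0$ ($h_n>0$) and $v_n\to v$ with $x^*+h_nv_n\in M$ for all $n$. *)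

(* Defs.v *)
From HB Require Import structures.
From mathcomp Require Import all_boot all_order all_algebra.
From mathcomp Require Import all_classical all_reals all_analysis.
Import Order.TTheory GRing.Theory Num.Theory.
Import numFieldNormedType.Exports.

Set Implicit Arguments.
Unset Strict Implicit.
Unset Printing Implicit Defensive.

Local Open Scope classical_set_scope.
Local Open Scope ring_scope.

Definition edom (R : realType) (X : Type) (f : X -> \bar R) : set X :=
  [set x | f x \is a fin_num].

Definition shift_closed (R : realType) (X : Type) (H : set (X -> \bar R)) :=
  forall (h : X -> \bar R) (c : R), H h -> H (fun x => (h x + c%:E)%E).

Definition Hconvex (R : realType) (X : Type) (H : set (X -> \bar R))
    (phi : X -> \bar R) :=
  exists U : set (X -> \bar R),
    [/\ U !=set0, U `<=` H & forall x, phi x = ereal_sup [set h x | h in U]].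

(* [beta] is a total function, but only its values on the closed ball of
   radius [r] matter: that ball is a neighbourhood of 0. The limit is taken
   over d <> 0; the value [beta 0] is multiplied by the norm of 0. *)
Definition strong_upper_Hconvex_approx (R : realType) (X : normedModType R)
    (H : set (X -> \bar R)) (f : X -> R) (x : X) (phi : X -> \bar R) :=
  [/\ Hconvex H phi,
      (0 <= phi 0%R)%E /\ interior (edom phi) 0 &
      exists (r : R) (beta : X -> R),
        [/\ 0 < r,
            beta d @[d --> (0 : X)^'] --> (0 : R) &
            forall d : X, `|d| <= r ->
              ((f (x + d) - f x)%:E <= phi d + (`|d| * beta d)%:E)%E]].

(* An extended-real function is Lipschitz near [x] when it is finite on some
   neighbourhood of [x] and Lipschitz there as a real-valued function. *)
Definition lipschitz_near (R : realType) (X : normedModType R)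
    (phi : X -> \bar R) (x : X) :=
  exists U : set X,
    [/\ nbhs x U, U `<=` edom phi & [lipschitz fine (phi y) | y in U]].

Definition subhomogeneous (R : realType) (X : normedModType R)
    (f : X -> \bar R) :=
  f 0 = 0%E /\
  forall (d : X) (a : R), 0 < a < 1 -> (f (a *: d) <= a%:E * f d)%E.

Definition contingent_cone (R : realType) (X : normedModType R)
    (M : set X) (x : X) : set X :=
  [set v | exists (h : nat -> R) (w : nat -> X),
    [/\ forall k, 0 < h k,
        h k @[k --> \oo] --> (0 : R),
        w k @[k --> \oo] --> v &
        forall k, M (x + h k *: w k)]].

Definition local_min_on (R : realType) (X : normedModType R)
    (f : X -> R) (A : set X) (x : X) :=
  A x /\ \forall y \near x, A y -> f x <= f y.

Definition global_min_on (R : realType) (X : Type)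
    (g : X -> \bar R) (A : set X) (x : X) :=
  A x /\ forall y, A y -> (g x <= g y)%E.

(* Index [ord0] is the objective; the other indices are the constraints. *)
Definition feasible (R : realType) (X : Type) (n : nat)
    (f : 'I_n.+1 -> X -> R) (M : set X) : set X :=
  [set x | M x /\ forall i, i != ord0 -> f i x <= 0].

Definition approx_sup (R : realType) (X : Type) (n : nat)
    (f : 'I_n.+1 -> X -> R) (phi : 'I_n.+1 -> X -> \bar R) (xs : X) :
    X -> \bar R :=
  fun x => ereal_sup ([set phi ord0 x] `|`
    [set (phi i x + (f i xs)%:E)%E | i in [set i | i != ord0]]).

(* Main.v *)
Require Import Defs.
From mathcomp Require Import all_boot all_order all_algebra.
From mathcomp Require Import all_classical all_reals all_analysis.
From mathcomp Require Import ring lra.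
Import Order.TTheory GRing.Theory Num.Theory.
Import numFieldNormedType.Exports.
Local Open Scope classical_set_scope.
Local Open Scope ring_scope.

Set Implicit Arguments.
Unset Strict Implicit.

(** If [g v <= - c < 0] for some [v] in the contingent cone, subhomogeneity
    gives [g (h v) <= - c h] for small [h > 0]. Local Lipschitz continuity
    replaces [h v] by [h w_k] at a cost [o(h)], and the approximation property
    replaces each [phi i (h w_k)] by [f i (xs + h w_k) - f i xs] at a further
    cost [o(h)]. Hence the points [xs + h_k w_k] of [M] eventually satisfy
    all constraints and have a smaller objective value than [xs]. *)

(** Trades [r] and [beta] for an arbitrary slope [e]. The punctured limit says nothing about
    [beta 0], but at [d = 0] the factor [|d|] kills that value. *)
Lemma strong_upper_approx_near (R : realType) (X : normedModType R)
    (H : set (X -> \bar R)) (f : X -> R) (x : X) (phi : X -> \bar R) (e : R) :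
  strong_upper_Hconvex_approx H f x phi -> 0 < e ->
  \forall d \near (0 : X),
    ((f (x + d) - f x)%:E <= phi d + (e * `|d|)%:E)%E.
Proof.
move=> [_ _ [r [beta [r_gt0 beta0 fle]]]] e_gt0.
have beta_lt : \forall d \near (0 : X), d != 0 -> `|beta d| < e.
  exact: (cvgr0_norm_lt _ beta0 _ e_gt0).
near=> d.
have d_le_r : `|d| <= r by near: d; exact: nbhs0_le.
have betad_lt : d != 0 -> `|beta d| < e by near: d.
apply: (le_trans (fle d d_le_r)); apply: leeD => //; rewrite lee_fin mulrC.
have [->|d_neq0] := eqVneq d 0; first by rewrite normr0 !mulr0.
apply: ler_wpM2r => //; apply: (le_trans (ler_norm _)).
by apply: ltW; exact: betad_lt.
Unshelve. all: by end_near. Qed.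

(** The offset [a] lets one argument serve both roles: [a = 0] gives strict decrease of an
    objective, [a = f x] gives strict feasibility of a constraint. *)
Lemma approx_decrease_along (R : realType) (X : normedModType R)
    (H : set (X -> \bar R)) (f : X -> R) (x v : X) (phi : X -> \bar R)
    (a c : R) (h : nat -> R) (w : nat -> X) :
  strong_upper_Hconvex_approx H f x phi -> lipschitz_near phi 0 ->
  0 < c -> (forall k, 0 < h k) -> h k @[k --> \oo] --> (0 : R) ->
  w k @[k --> \oo] --> v ->
  (\forall k \near \oo, (phi (h k *: v) + a%:E <= (- (c * h k))%:E)%E) ->
  \forall k \near \oo, f (x + h k *: w k) - f x + a < 0.
Proof.
move=> approx [U [U0 Udom Ulip]] c_gt0 h_gt0 h_to0 w_tov phi_le.
have [L L_gt0 {}Ulip] := pinfty_ex_gt0 Ulip.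
have hw_to0 : h k *: w k @[k --> \oo] --> (0 : X).
  by rewrite -[0](scale0r v); exact: cvgZ.
have hv_to0 : h k *: v @[k --> \oo] --> (0 : X).
  by rewrite -[X in _ --> X](scale0r v); apply: cvgZ => //; exact: cvg_cst.
pose B := `|v| + 1.
have B_gt0 : 0 < B by rewrite /B ltr_wpDl.
(* The available decrease is [c * h k]. Since eventually [|w k| <= B], slope [c / (4 * B)] makes the
   approximation error cost at most a quarter of it; [|w k - v| <= c / (4 * L)] does the same for
   the Lipschitz error. Half of the decrease survives. *)
have e_gt0 : 0 < c / (4 * B) by rewrite divr_gt0// mulr_gt0.
have d_gt0 : 0 < c / (4 * L) by rewrite divr_gt0// mulr_gt0.
have f_near := hw_to0 _ (strong_upper_approx_near approx e_gt0).
near=> k.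
have f_le : ((f (x + h k *: w k) - f x)%:E <=
    phi (h k *: w k) + (c / (4 * B) * `|h k *: w k|)%:E)%E.
  by near: k; exact: f_near.
have Uw : U (h k *: w k) by near: k; exact: hw_to0.
have Uv : U (h k *: v) by near: k; exact: hv_to0.
have w_le : `|w k| <= B.
  by near: k; apply: (cvgr_norm_le _ w_tov); rewrite ltrDl.
have wv_le : `|w k - v| <= c / (4 * L).
  by near: k; exact: (cvgr_distC_le _ _ w_tov).
have phik : (phi (h k *: v) + a%:E <= (- (c * h k))%:E)%E by near: k.
have /= lip := Ulip (h k *: w k, h k *: v) (conj Uw Uv).
(* Both points lie in [U], where [phi] is finite, so all the estimates become real inequalities. *)
move: (Udom _ Uw) (Udom _ Uv) => /= /fineK wK /fineK vK.
move: f_le phik lip; rewrite -wK -vK -!EFinD !lee_fin /=.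
rewrite -scalerBr !normrZ (gtr0_norm (h_gt0 k)) => f_le phik.
move=> /(le_trans (ler_norm _)) lip.
have hk := h_gt0 k.
have w_cost : c / (4 * B) * (h k * `|w k|) <= c / 4 * h k.
  apply: (@le_trans _ _ (c / (4 * B) * (h k * B))).
    by rewrite ler_pM2l// ler_pM2l.
  by rewrite le_eqVlt; apply/orP; left; apply/eqP; field; rewrite gt_eqF.
have v_cost : L * (h k * `|w k - v|) <= c / 4 * h k.
  apply: (@le_trans _ _ (L * (h k * (c / (4 * L))))).
    by rewrite ler_pM2l// ler_pM2l.
  by rewrite le_eqVlt; apply/orP; left; apply/eqP; field; rewrite gt_eqF.
have chk : 0 < c * h k by exact: mulr_gt0.
lra.
Unshelve. all: by end_near. Qed.

(** The conditional offset treats the unshifted objective and the shifted constraints uniformly. *)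
Lemma approx_sup_ge (R : realType) (X : Type) (n : nat)
    (f : 'I_n.+1 -> X -> R) (phi : 'I_n.+1 -> X -> \bar R) (xs x : X) i :
  (phi i x + (if i == ord0 then 0 else f i xs)%:E
     <= approx_sup f phi xs x)%E.
Proof.
apply: ereal_sup_ubound; case: (eqVneq i ord0) => [->|i_neq0].
  by left; rewrite /= adde0.
by right; exists i.
Qed.

Lemma contingent_cone0 (R : realType) (X : normedModType R)
    (M : set X) (x : X) :
  M x -> contingent_cone M x 0.
Proof.
move=> Mx; exists (@harmonic R), (fun=> 0); split.
- exact: harmonic_gt0.
- exact: cvg_harmonic.
- exact: cvg_cst.
- by move=> k; rewrite scaler0 addr0.
Qed.

Theorem theorem5p4 (R : realType) (X : normedModType R)
    (Omega M : set X) (H : set (X -> \bar R)) (n : nat)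
    (f : 'I_n.+1 -> X -> R) (xs : X) (phi : 'I_n.+1 -> X -> \bar R)
    (Omega_open : open Omega) (M_sub : M `<=` Omega) (M_neq0 : M !=set0)
    (H_neq0 : H !=set0) (H_shift : shift_closed H)
    (xs_min : local_min_on (f ord0) (feasible f M) xs)
    (phi_approx : forall i, strong_upper_Hconvex_approx H (f i) xs (phi i))
    (phi0 : forall i, phi i 0 = 0%E)
    (phi_lip : forall i, lipschitz_near (phi i) 0)
    (g_subhom : subhomogeneous (approx_sup f phi xs)) :
  global_min_on (approx_sup f phi xs) (contingent_cone M xs) 0.
Proof.
have [[Mxs _] f0_min] := xs_min; have [g0 g_sub] := g_subhom.
split=> [|v [h [w [h_gt0 h_to0 w_tov Mhw]]]]; first exact: contingent_cone0.
rewrite g0 leNgt; apply/negP => gv_lt0.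
have [c c_gt0 gv_le] : exists2 c : R, 0 < c &
    (approx_sup f phi xs v <= (- c)%:E)%E.
  (* The value at [v] may be [-oo]; any positive [c] then works. *)
  case: (approx_sup f phi xs v) gv_lt0 => [r| |]//.
    by rewrite lte_fin => r_lt0; exists (- r); rewrite ?oppr_gt0 ?opprK.
  by exists 1; rewrite ?leNye.
have decr : \forall k \near \oo, forall i,
    f i (xs + h k *: w k) - f i xs + (if i == ord0 then 0 else f i xs) < 0.
  (* There are finitely many indices, so one threshold on [k] serves them all. *)
  apply: filter_forall => i.
  apply: (approx_decrease_along (phi_approx i) (phi_lip i) c_gt0) w_tov _ => //.
  near=> k; apply: (le_trans (approx_sup_ge _ _ _ _ _)).
  apply: (@le_trans _ _ ((h k)%:E * approx_sup f phi xs v)%E).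
    (* Subhomogeneity needs a factor below 1, which [h k] eventually is. *)
    apply: g_sub; rewrite h_gt0 /=; near: k; exact: (cvgr_lt _ h_to0).
  by rewrite mulrC -mulrN EFinM lee_pmul2l// lte_fin.
have xhw_to : xs + h k *: w k @[k --> \oo] --> xs.
  rewrite -[X in _ --> X]addr0 -(scale0r v).
  by apply: cvgD; [exact: cvg_cst|exact: cvgZ].
have [k [decrk f0_le]] : exists k, (forall i,
    f i (xs + h k *: w k) - f i xs + (if i == ord0 then 0 else f i xs) < 0) /\
    (feasible f M (xs + h k *: w k) -> f ord0 xs <= f ord0 (xs + h k *: w k)).
  apply: (@filter_ex _ \oo); apply: filterI => //; exact: (xhw_to _ f0_min).
have := decrk ord0; rewrite eqxx addr0 subr_lt0 ltNge => /negP; apply.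
apply: f0_le; split=> // i i_neq0; apply: ltW.
(* For a constraint the offset [f i xs] cancels, leaving a negative value at the new point. *)
by have := decrk i; rewrite (negbTE i_neq0) subrK.
Unshelve. all: by end_near. Qed.
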